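(* Let $q>1$ be a real number and let $\mathbb{E}$ be a complex Banach space. The sequence $([p]_{1/q}!)_{p\ge0}$ preserves summability and it also preserves $q$-Gevrey asymptotic expansions.
   Context: $q$-factorials: $[n]_{1/q}=\frac{(1/q)^n-1}{(1/q)-1}$ for $n\in\mathbb{N}$, $[0]_{1/q}!=1$ and $[n]_{1/q}!=[1]_{1/q}[2]_{1/q}\cdots[n]_{1/q}$ for $n\ge1$. $\mathbb{E}$ is a complex Banach space with norm $\|\cdot\|_{\mathbb{E}}$; $\mathbb{E}[[t]]$ is the space of formal power series in $t$ with coefficients in $\mathbb{E}$ and $\mathbb{E}\{t\}$ is the subspace of those which converge on some neighborhood of the origin. Infinite sector: for $d\in\mathbb{R}$, an infinite sector with vertex at the origin, bisecting direction $d$ and positive opening $\delta>0$ is $S=\{re^{i\varphi}: r>0,\ |\varphi-d|<\delta/2\}$. A convergent power series $g$ can be extended on $S$ if there are $\rho>0$ and a holomorphic function on $S\cup D_\rho$ ($D_\rho$ the open disc of radius $\rho$ centered at $0$) which coincides with the sum of $g$ on $D_\rho$; ''can be extended on an infinite sector of bisecting direction $d$'' means that this holds for some such $S$ (some positive opening). $q$-exponential growth: for $s>0$, a holomorphic function $f:S\to\mathbb{E}$ is of $q$-exponential growth of order $1/s$ on $S$ if there exist $C,h>0$ and $\alpha\in\mathbb{R}$ such that $\|f(z)\|_{\mathbb{E}}\le C\exp\left(\frac{\log^2(|z|+h)}{2s\log(q)}\right)(|z|+h)^{\alpha}$ for every $z\in S$. Formal Borel operators: for a sequence $m=(m_p)_{p\ge0}$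 of positive real numbers, $\mathcal{B}_{m,t}\left(\sum_{p\ge0}a_pt^p\right)=\sum_{p\ge0}\frac{a_p}{m_p}t^p$. For $s>0$, $\mathcal{B}_{q;s}\left(\sum_{p\ge0}a_pt^p\right)=\sum_{p\ge0}\frac{a_p}{q^{s p(p-1)/2}}t^p$. Definition: a sequence $m$ of positive real numbers with $m_0=1$ preserves $q$-Gevrey asymptotic expansions if for every $s>0$, $d\in\mathbb{R}$ and $\hat{u}\in\mathbb{E}[[t]]$ the following two statements are equivalent: (i) $\mathcal{B}_{q;s}(\hat{u})\in\mathbb{E}\{t\}$, and this function can be extended on an infinite sector of bisecting direction $d$ with $q$-exponential growth of order $1/s$ on such sector; (ii) $\mathcal{B}_{q;s}\mathcal{B}_{m,t}(\hat{u})\in\mathbb{E}\{t\}$, and this function can be extended on an infinite sector of bisecting direction $d$ with $q$-exponential growth of order $1/s$ on such sector. Summability: for $k>0$ and $d\in\mathbb{R}$, a series $\hat{u}(t)=\sum_{p\ge0}a_pt^p\in\mathbb{E}[[t]]$ is $k$-summable along direction $d$, written $\hat{u}\in\mathbb{E}\{t\}_{k,d}$, if $\sum_{p\ge0}\frac{a_p}{\Gamma(1+p/k)}t^p$ converges on some neighborhood of the origin and can be extended analytically, as a function $v$, to an infinite sector $S$ of bisecting direction $d$, with $k$-exponential growth there, i.e. there exist $A,B>0$ such that $\|v(t)\|_{\mathbb{E}}\le Ae^{B|t|^{k}}$ for all $t\in S$. Definition: a sequence $m$ of positive real numbers with $m_0=1$ preserves summability if for every $k>0$, $d\in\mathbb{R}$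 and $\hat{u}\in\mathbb{E}[[t]]$ one has $\hat{u}\in\mathbb{E}\{t\}_{k,d}$ if and only if $\mathcal{B}_{m,t}\hat{u}\in\mathbb{E}\{t\}_{k,d}$. *)

(* Defs.v *)
(* Stdlib reals and Coquelicot.  A complex Banach space is a
   [CompleteNormedModule C_AbsRing]; a formal power series with coefficients
   in [E] is its coefficient sequence [nat -> E]. *)
From Stdlib Require Import Reals.
From Coquelicot Require Import Coquelicot.
Set Implicit Arguments.
Open Scope R_scope.

Definition qnumber (x : R) (n : nat) : R := (x ^ n - 1) / (x - 1).

Fixpoint qfactorial (x : R) (n : nat) : R :=
  match n with
  | O => 1
  | S n' => qfactorial x n' * qnumber x n
  end.

(* [Rpower t (x - 1)] is t^(x-1) for t > 0, which is all the integral sees. *)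
Definition Gamma (x : R) : R :=
  RInt_gen (fun t : R => Rpower t (x - 1) * exp (- t))
    (at_right 0) (Rbar_locally p_infty).

Definition disc (rho : R) (z : C) : Prop := Cmod z < rho.

(* [delta] is the full opening, [d] the bisecting direction. *)
Definition sector (d delta : R) (z : C) : Prop :=
  exists r phi : R,
    0 < r /\ Rabs (phi - d) < delta / 2 /\ z = (r * cos phi, r * sin phi).

(* Only used for open [U], so that differentiability of the total function
   [f] at the points of [U] depends only on the restriction of [f] to [U]. *)
Definition holomorphic_on {E : CompleteNormedModule C_AbsRing}
    (U : C -> Prop) (f : C -> E) : Prop :=
  forall z : C, U z -> @ex_derive C_AbsRing E f z.

Definition convergent {E : CompleteNormedModule C_AbsRing}
    (u : nat -> E) : Prop :=
  exists r : R, 0 < r /\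
    forall z : C, disc r z -> @ex_pseries C_AbsRing E u z.

(* The conjunct [is_pseries] says that [u] converges at [z] with sum [f z]. *)
Definition extension_on {E : CompleteNormedModule C_AbsRing}
    (u : nat -> E) (U : C -> Prop) (f : C -> E) : Prop :=
  exists rho : R, 0 < rho /\
    holomorphic_on (fun z => U z \/ disc rho z) f /\
    forall z : C, disc rho z -> @is_pseries C_AbsRing E u z (f z).

Definition q_exponential_growth {E : CompleteNormedModule C_AbsRing}
    (q s : R) (U : C -> Prop) (f : C -> E) : Prop :=
  exists c h alpha : R, 0 < c /\ 0 < h /\
    forall z : C, U z ->
      norm (f z) <=
        c * exp ((ln (Cmod z + h)) ^ 2 / (2 * s * ln q))
          * Rpower (Cmod z + h) alpha.

Definition exponential_growth {E : CompleteNormedModule C_AbsRing}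
    (k : R) (U : C -> Prop) (f : C -> E) : Prop :=
  exists A B : R, 0 < A /\ 0 < B /\
    forall z : C, U z -> norm (f z) <= A * exp (B * Rpower (Cmod z) k).

Definition borel {E : CompleteNormedModule C_AbsRing}
    (m : nat -> R) (u : nat -> E) : nat -> E :=
  fun p => @scal C_AbsRing E (RtoC (/ m p)) (u p).

Definition q_borel {E : CompleteNormedModule C_AbsRing}
    (q s : R) (u : nat -> E) : nat -> E :=
  borel (fun p => Rpower q (s * INR p * (INR p - 1) / 2)) u.

Definition q_extendable {E : CompleteNormedModule C_AbsRing}
    (q s d : R) (v : nat -> E) : Prop :=
  convergent v /\
  exists (delta : R) (f : C -> E), 0 < delta /\
    extension_on v (sector d delta) f /\
    q_exponential_growth q s (sector d delta) f.

Definition summable {E : CompleteNormedModule C_AbsRing}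
    (k d : R) (u : nat -> E) : Prop :=
  let v := borel (fun p => Gamma (1 + INR p / k)) u in
  convergent v /\
  exists (delta : R) (f : C -> E), 0 < delta /\
    extension_on v (sector d delta) f /\
    exponential_growth k (sector d delta) f.

Definition normalized_positive (m : nat -> R) : Prop :=
  m O = 1 /\ forall p : nat, 0 < m p.

Definition preserves_q_Gevrey (E : CompleteNormedModule C_AbsRing)
    (q : R) (m : nat -> R) : Prop :=
  normalized_positive m /\
  forall (s d : R) (u : nat -> E), 0 < s ->
    (q_extendable q s d (q_borel q s u) <->
     q_extendable q s d (q_borel q s (borel m u))).

Definition preserves_summability (E : CompleteNormedModule C_AbsRing)
    (m : nat -> R) : Prop :=
  normalized_positive m /\
  forall (k d : R) (u : nat -> E), 0 < k ->
    (summable k d u <-> summable k d (borel m u)).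

(* Main.v *)
(* Put x = 1/q and let (x;x)_p = (1-x)(1-x^2)...(1-x^p), so that the p-th
   q-factorial is (x;x)_p / (1-x)^p.  By Euler's two expansions both it and its
   inverse have the form W_p = sum_n e_n (mu x^n)^p with sum_n |e_n| finite and
   mu > 0.  Multiplying the coefficients of f by such a W_p gives
   g(z) = sum_n e_n f(mu x^n z), a superposition of dilations towards the
   origin: it extends wherever f does, and |g(z)| is controlled by the growth
   of f at radius mu |z|.  Dilation by mu only changes the constants in both
   growth conditions, and multiplication by W commutes with every formal Borel
   operator. *)
Require Import Defs.
From Stdlib Require Import Reals Lra Lia FunctionalExtensionality.
From Coquelicot Require Import Coquelicot.
(* Coquelicot's own [disc] would otherwise shadow the one of [Defs]. *)
Import Defs.
Open Scope R_scope.

(** Each equivalence is one statement used twice, for W and for 1/W, which is why both Euler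
    expansions are needed. No infinite product is formed. A series F with F(xy) = (1-y) F(y)
    satisfies F(x^(p+1)) = (x;x)_p F(x), and a series G with G(y) = (1-y) G(xy) satisfies G(x) =
    (x;x)_p G(x^(p+1)). So (x;x)_p and its inverse are, up to a constant, values at x^(p+1) of power
    series, and sum_n c_n x^(n(p+1)) = sum_n (c_n x^n) (x^n)^p displays the weights and the
    dilations. Dividing by the constant F(x) is safe by positivity; G has signed coefficients, so
    G(x) <> 0 needs its own argument. For the q-factorial mu = 1/(1-x) exceeds 1, so the first
    dilations may point away from the origin. This is harmless: sectors are invariant under every
    positive dilation, and the disc of convergence is merely shrunk by the factor mu. The growth
    condition in q is not monotone in |z| as stated, so it is first replaced by a nondecreasing
    majorant; its free power of |z| + h then absorbs what the squared logarithm produces under a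
    dilation. *)

Lemma plus_minus_cancel {G : AbelianGroup} (x y : G) : plus (minus x y) y = x.
Proof. unfold minus; now rewrite <- plus_assoc, plus_opp_l, plus_zero_r. Qed.

Lemma minus_plus_cancel {G : AbelianGroup} (x y : G) : minus (plus x y) x = y.
Proof.
unfold minus. rewrite (plus_comm x), <- plus_assoc.
etransitivity; [apply f_equal, plus_opp_r|apply plus_zero_r].
Qed.

Lemma norm_minus_le {K : AbsRing} {V : NormedModule K} (x y : V) :
  norm (minus x y) <= norm x + norm y.
Proof. rewrite <- (norm_opp y). exact (norm_triangle x (opp y)). Qed.

Lemma is_series_norm_le {K : AbsRing} {V : NormedModule K}
    (a : nat -> V) (b : nat -> R) (l : V) (s : R) :
  (forall n, norm (a n) <= b n) -> is_series a l -> is_series b s -> norm l <= s.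
Proof.
intros Hab Ha Hb.
apply (is_lim_seq_le (fun n => norm (sum_n a n)) (sum_n b) (norm l) s).
- intros n. eapply Rle_trans; [apply norm_sum_n_m|].
  apply sum_n_m_le; exact Hab.
- eapply filterlim_comp; [exact Ha|apply filterlim_norm].
- exact Hb.
Qed.

Lemma is_series_unique_normed {K : AbsRing} {V : NormedModule K}
    (a : nat -> V) (l l' : V) : is_series a l -> is_series a l' -> l = l'.
Proof. intros H H'; exact (filterlim_locally_unique _ _ _ H H'). Qed.

Lemma geometric_tail_bound {K : AbsRing} {V : NormedModule K}
    (a : nat -> V) (l : V) (M t : R) (P : nat) :
  0 <= t < 1 -> (forall n, norm (a n) <= M * t ^ n) -> is_series a l ->
  norm (minus l (sum_n a P)) <= M * t ^ S P / (1 - t).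
Proof.
intros Ht HM Ha.
assert (Htail : is_series (fun k => a (S P + k)%nat) (minus l (sum_n a P))).
{ apply is_series_incr_n; [lia|]. simpl pred.
  eapply eq_ind_r; [exact Ha|exact (plus_minus_cancel (G := V) l (sum_n a P))]. }
apply (is_series_norm_le _ (fun k => (M * t ^ S P) * t ^ k) _ _) with (2 := Htail).
- intros n. rewrite Rmult_assoc, <- pow_add. apply HM.
- apply (is_series_scal (M * t ^ S P) (fun k => t ^ k) (/ (1 - t))).
  apply is_series_geom. rewrite Rabs_pos_eq; lra.
Qed.

(** * Power series with vector coefficients: bounds and complex differentiability *)

Lemma C_pow_n (z : C) (n : nat) : @pow_n C_Ring z n = (z ^ n)%C.
Proof.
induction n as [|n IH]; [reflexivity|].
rewrite Cpow_S, <- IH; reflexivity.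
Qed.

Lemma norm_scal_C {V : NormedModule C_AbsRing} (c : C) (u : V) :
  norm (scal c u) <= Cmod c * norm u.
Proof. exact (norm_scal c u). Qed.

Lemma scal_C_minus2 {V : ModuleSpace C_Ring} (b c d : C) (u : V) :
  minus (minus (scal b u) (scal c u)) (scal d u) = scal (b - c - d)%C u.
Proof.
symmetry. etransitivity; [exact (scal_minus_distr_r (b - c)%C d u)|].
apply (f_equal (fun v => minus v (scal d u))). exact (scal_minus_distr_r b c u).
Qed.

(** Convergent partial sums have a common bound M, and each term after the first is a difference of
    two consecutive ones; hence 2 M. *)
Lemma pseries_coefficient_bound {V : NormedModule C_AbsRing}
    (v : nat -> V) (r : R) :
  0 < r -> @ex_pseries C_AbsRing V v (RtoC r) ->
  exists K, 0 <= K /\ forall p, norm (v p) * r ^ p <= K.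
Proof.
intros Hr [l Hl].
destruct (filterlim_bounded _ (ex_intro _ l Hl)) as [M HM].
assert (HM0 : 0 <= M) by (eapply Rle_trans; [|apply (HM O)]; apply norm_ge_0).
exists (2 * M); split; [lra|intros p].
assert (Hp : norm (scal (RtoC r ^ p)%C (v p)) <= 2 * M).
{ rewrite <- (C_pow_n (RtoC r)). destruct p as [|p].
  - specialize (HM O). rewrite sum_O in HM. eapply Rle_trans; [exact HM|lra].
  - set (s := fun k => scal (@pow_n C_Ring (RtoC r) k) (v k)) in HM.
    assert (E : scal (@pow_n C_Ring (RtoC r) (S p)) (v (S p))
                = minus (sum_n s (S p)) (sum_n s p)).
    { rewrite sum_Sn. symmetry. exact (minus_plus_cancel (G := V) (sum_n s p) (s (S p))). }
    rewrite E. eapply Rle_trans; [apply (norm_minus_le (V := V))|].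
    eapply Rle_trans; [apply Rplus_le_compat; apply HM|lra]. }
assert (Hrp : 0 < r ^ p) by now apply pow_lt.
assert (E : v p = scal (/ (RtoC r ^ p))%C (scal (RtoC r ^ p)%C (v p))).
{ rewrite scal_assoc.
  replace (mult (/ RtoC r ^ p)%C (RtoC r ^ p)%C) with (one : C_AbsRing).
  - now rewrite scal_one.
  - symmetry. apply Cinv_l. apply Cpow_nz. intros H. apply RtoC_inj in H. lra. }
assert (Hv : norm (v p) <= / r ^ p * (2 * M)).
{ rewrite E. eapply Rle_trans; [apply (norm_scal_C (V := V))|].
  rewrite <- RtoC_pow, <- RtoC_inv by lra.
  rewrite Cmod_R, Rabs_pos_eq by (left; now apply Rinv_0_lt_compat).
  apply Rmult_le_compat_l; [left; now apply Rinv_0_lt_compat|].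
  rewrite RtoC_pow. exact Hp. }
apply Rmult_le_compat_r with (r := r ^ p) in Hv; [|lra].
eapply Rle_trans; [exact Hv|]. right. field. lra.
Qed.

Lemma pow_derivative_bound (a delta : R) (p : nat) :
  0 <= a -> 0 <= delta ->
  INR p * a ^ pred p * delta <= (a + delta) ^ p.
Proof.
intros Ha Hd. induction p as [|[|p] IH].
- simpl; lra.
- simpl; lra.
- rewrite S_INR. simpl pred in *.
  change (a ^ S p) with (a * a ^ p).
  change ((a + delta) ^ S (S p)) with ((a + delta) * (a + delta) ^ S p).
  assert (a ^ S p <= (a + delta) ^ S p) by (apply pow_incr; lra).
  assert (0 <= a ^ p) by now apply pow_le.
  change (a ^ S p) with (a * a ^ p) in *.
  nra.
Qed.

(** In the binomial expansion the remainder keeps only the degrees j >= 2 in h, where |h|^j <= (|h|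
    / delta)^2 delta^j. It is thus majorized by the same remainder formed with the real numbers |w|
    and delta. *)
Lemma pow_remainder_bound (w h : C) (delta : R) (p : nat) :
  0 < delta -> Cmod h <= delta ->
  Cmod ((w + h) ^ p - w ^ p - INR p * w ^ pred p * h)%C <=
  (Cmod h / delta) ^ 2 *
    ((Cmod w + delta) ^ p - Cmod w ^ p - INR p * Cmod w ^ pred p * delta).
Proof.
intros Hd Hh.
induction p as [|p IH].
- simpl. rewrite Rmult_0_l, Rmult_0_l, !Rminus_0_r, Rminus_diag, Rmult_0_r.
  replace (1 - 1 - 0 * 1 * h)%C with (RtoC 0) by ring. rewrite Cmod_0. lra.
(* The remainders obey R_(p+1) = (w + h) R_p + p w^(p-1) h^2. The majorant obeys the analogous
   recursion in |w| and delta with equality, which closes the induction. *)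
- replace ((w + h) ^ S p - w ^ S p - INR (S p) * w ^ pred (S p) * h)%C
    with ((w + h) * ((w + h) ^ p - w ^ p - INR p * w ^ pred p * h)
          + INR p * w ^ pred p * (h * h))%C.
  2:{ rewrite S_INR, RtoC_plus, !Cpow_S. simpl pred. destruct p as [|p].
      - simpl. ring.
      - simpl pred. rewrite !Cpow_S. ring. }
  eapply Rle_trans; [apply Cmod_triangle|]. rewrite !Cmod_mult.
  rewrite Cmod_pow, Cmod_R, (Rabs_pos_eq (INR p)) by apply pos_INR.
  assert (H1 : Cmod (w + h) <= Cmod w + delta)
    by (eapply Rle_trans; [apply Cmod_triangle|lra]).
  set (A := Cmod (_ - _)%C) in *.
  assert (HA : 0 <= A) by apply Cmod_ge_0.
  assert (H2 : Cmod (w + h) * A <= (Cmod w + delta) * A)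
    by (apply Rmult_le_compat_r; assumption).
  assert (H3 := Rmult_le_compat_l (Cmod w + delta) _ _
     ltac:(generalize (Cmod_ge_0 w); lra) IH).
  eapply Rle_trans; [apply Rplus_le_compat_r; eapply Rle_trans; [exact H2|exact H3]|].
  right. rewrite S_INR. simpl pred. destruct p as [|p]; simpl; field; lra.
Qed.

Lemma is_derive_of_quadratic_remainder {V : NormedModule C_AbsRing}
    (f : C -> V) (z : C) (D : V) (M delta : R) :
  0 < delta ->
  (forall h, Cmod h < delta ->
     norm (minus (minus (f (z + h)%C) (f z)) (scal h D)) <= M * Cmod h ^ 2) ->
  @is_derive C_AbsRing V f z D.
Proof.
intros Hd Hq. split; [apply is_linear_scal_l|].
intros y Hy. apply (is_filter_lim_locally_unique (V := AbsRing_NormedModule C_AbsRing)) in Hy. subst y.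
intros eps.
(* [M] may be zero or negative, whereas [eps / N] is always a legitimate radius. *)
set (N := Rmax M 1).
assert (HN : 1 <= N) by apply Rmax_r.
assert (He : 0 < eps / N) by (apply Rdiv_lt_0_compat; [apply cond_pos|lra]).
exists (mkposreal _ (Rmin_pos _ _ Hd He)). intros y Hy.
assert (Hb : Cmod (y - z) < Rmin delta (eps / N)) by exact Hy.
change (minus y z) with (y - z)%C.
change (norm (y - z)%C) with (Cmod (y - z)).
set (h := (y - z)%C) in *.
replace y with (z + h)%C by (unfold h; ring).
eapply Rle_trans; [apply Hq; eapply Rlt_le_trans; [exact Hb|apply Rmin_l]|].
assert (H2 : Cmod h < eps / N) by (eapply Rlt_le_trans; [exact Hb|apply Rmin_r]).
assert (H0 := Cmod_ge_0 h).
assert (HMN : M <= N) by apply Rmax_l.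
assert (H4 : N * Cmod h <= eps).
{ apply Rmult_lt_compat_l with (r := N) in H2; [|lra].
  replace (N * (eps / N)) with (pos eps) in H2 by (field; lra). lra. }
change (norm h) with (Cmod h).
replace (M * Cmod h ^ 2) with (M * Cmod h * Cmod h) by ring.
apply Rmult_le_compat_r; [assumption|]. nra.
Qed.

Lemma pseries_ex_derive {V : CompleteNormedModule C_AbsRing}
    (a : nat -> V) (f : C -> V) (rho : R) (z : C) :
  (forall w : C, disc rho w -> @is_pseries C_AbsRing V a w (f w)) ->
  disc rho z -> @ex_derive C_AbsRing V f z.
Proof.
intros Hf Hz. unfold disc in *.
assert (Hz0 := Cmod_ge_0 z).
(* Thirds leave room for |z| < [r1] < [r2] < [rho]: coefficients are bounded at [r2], the derived
   series and the remainders are majorized at [r1], and [r1 / r2] is the ratio of the geometric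
   majorant. *)
set (delta := (rho - Cmod z) / 3).
assert (Hdelta : 0 < delta) by (unfold delta; lra).
set (r1 := Cmod z + delta). set (r2 := Cmod z + 2 * delta).
assert (Hr : 0 < r1 < r2) by (unfold r1, r2; lra).
destruct (pseries_coefficient_bound a r2) as [K [HK Ha]]; [lra| |].
{ exists (f (RtoC r2)). apply Hf. rewrite Cmod_R, Rabs_pos_eq; unfold r2, delta in *; lra. }
set (t := r1 / r2).
assert (Ht : 0 <= t < 1).
{ unfold t; split; [apply Rdiv_le_0_compat; lra|].
  apply (Rmult_lt_reg_r r2); [lra|]. replace (r1 / r2 * r2) with r1 by (field; lra). lra. }
assert (Hap : forall p, r1 ^ p * norm (a p) <= K * t ^ p).
{ intros p. replace (r1 ^ p) with (t ^ p * r2 ^ p)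
    by (rewrite <- Rpow_mult_distr; f_equal; unfold t; field; lra).
  generalize (Ha p) (pow_le t p (proj1 Ht)); intros H1 H2. nra. }
assert (Hgeom : forall M, is_series (fun p => M * t ^ p) (M * / (1 - t))).
{ intros M. apply (is_series_scal M (fun p => t ^ p) (/ (1 - t))).
  apply is_series_geom. rewrite Rabs_pos_eq; lra. }
assert (HD : ex_series (fun p => scal (INR p * z ^ pred p)%C (a p))).
{ apply (ex_series_le _ (fun p => (K / delta) * t ^ p)); [|eexists; apply Hgeom].
  intros p. eapply Rle_trans; [apply (norm_scal_C (V := V))|].
  rewrite Cmod_mult, Cmod_pow, Cmod_R, Rabs_pos_eq by apply pos_INR.
  assert (H := pow_derivative_bound (Cmod z) delta p Hz0 ltac:(lra)).
  fold r1 in H. apply (Rmult_le_reg_r delta); [lra|].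
  replace (K / delta * t ^ p * delta) with (K * t ^ p) by (field; lra).
  eapply Rle_trans; [|apply (Hap p)].
  generalize (norm_ge_0 (a p)); intros; nra. }
destruct HD as [D HD]. exists D.
apply (is_derive_of_quadratic_remainder f z D (K / delta ^ 2 * / (1 - t)) delta Hdelta).
intros h Hh.
assert (Hs : is_series
   (fun p => scal ((z + h) ^ p - z ^ p - INR p * z ^ pred p * h)%C (a p))
   (minus (minus (f (z + h)%C) (f z)) (scal h D))).
{ assert (H1 := Hf (z + h)%C ltac:(eapply Rle_lt_trans; [apply Cmod_triangle|unfold delta in *; lra])).
  assert (H2 := Hf z Hz).
  assert (H3 := is_series_scal h _ _ HD).
  assert (H4 := is_series_minus _ _ _ _ (is_series_minus _ _ _ _ H1 H2) H3).
  eapply is_series_ext; [|exact H4]. intros p. cbv beta.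
  rewrite scal_assoc, !C_pow_n.
  etransitivity; [exact (scal_C_minus2 (V := V) ((z + h) ^ p)%C (z ^ p)%C
    (h * (INR p * z ^ pred p))%C (a p))|]. f_equal. ring. }
eapply is_series_norm_le with (2 := Hs)
  (b := fun p => (Cmod h ^ 2 * (K / delta ^ 2)) * t ^ p).
- intros p. eapply Rle_trans; [apply (norm_scal_C (V := V))|].
  assert (H := pow_remainder_bound z h delta p Hdelta ltac:(lra)). fold r1 in H.
  assert (H5 : Cmod ((z + h) ^ p - z ^ p - INR p * z ^ pred p * h)
               <= (Cmod h / delta) ^ 2 * r1 ^ p).
  { eapply Rle_trans; [exact H|]. apply Rmult_le_compat_l; [apply pow2_ge_0|].
    assert (0 <= Cmod z ^ p) by now apply pow_le.
    assert (0 <= INR p * Cmod z ^ pred p * delta).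
    { apply Rmult_le_pos; [apply Rmult_le_pos; [apply pos_INR|now apply pow_le]|lra]. }
    lra. }
  eapply Rle_trans; [apply Rmult_le_compat_r; [apply norm_ge_0|exact H5]|].
  replace (Cmod h ^ 2 * (K / delta ^ 2) * t ^ p)
    with ((Cmod h / delta) ^ 2 * (K * t ^ p)) by (field; lra).
  rewrite Rmult_assoc. apply Rmult_le_compat_l; [apply pow2_ge_0|apply Hap].
- replace (K / delta ^ 2 * / (1 - t) * Cmod h ^ 2)
    with (Cmod h ^ 2 * (K / delta ^ 2) * / (1 - t)) by ring.
  apply Hgeom.
Qed.

(** * Superpositions of dilations *)

Lemma filterlim_of_norm_bound {K : AbsRing} {V : NormedModule K}
    (s : nat -> V) (b : nat -> R) (l : V) :
  (forall n, norm (minus l (s n)) <= b n) -> is_lim_seq b 0 ->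
  filterlim s eventually (locally l).
Proof.
intros Hs Hb P [eps HP].
apply is_lim_seq_spec in Hb. destruct (Hb eps) as [N HN].
exists N. intros n Hn. apply HP, norm_compat1.
rewrite <- (norm_opp (minus (s n) l)), (opp_minus (s n) l).
eapply Rle_lt_trans; [apply Hs|]. specialize (HN n Hn).
rewrite Rminus_0_r in HN. eapply Rle_lt_trans; [apply Rle_abs|exact HN].
Qed.

Lemma is_series_scal_RtoC {V : NormedModule C_AbsRing}
    (a : nat -> R) (l : R) (u : V) :
  is_series a l -> is_series (fun n => scal (RtoC (a n)) u) (scal (RtoC l) u).
Proof.
intros Ha.
assert (Hsum : forall n, sum_n (fun n => scal (RtoC (a n)) u) n
                         = scal (RtoC (sum_n a n)) u).
{ induction n as [|n IH]; [now rewrite !sum_O|].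
  rewrite !sum_Sn, IH. change (plus (sum_n a n) (a (S n))) with (sum_n a n + a (S n)).
  rewrite RtoC_plus. symmetry.
  exact (scal_distr_r (RtoC (sum_n a n)) (RtoC (a (S n))) u). }
apply (filterlim_of_norm_bound (V := V) _ (fun n => Rabs (l - sum_n a n) * norm u)).
- intros n. rewrite Hsum.
  eapply Rle_trans with (norm (scal (RtoC (l - sum_n a n)) u)).
  + right. f_equal. rewrite RtoC_minus. symmetry.
    exact (scal_minus_distr_r (RtoC l) (RtoC (sum_n a n)) u).
  + eapply Rle_trans; [apply norm_scal_C|]. rewrite Cmod_R. apply Rle_refl.
- replace (Finite 0) with (Rbar_mult (Rabs (l - l)) (norm u)).
  + apply is_lim_seq_scal_r. apply (is_lim_seq_abs _ (Finite (l - l))).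
    apply is_lim_seq_minus'; [apply is_lim_seq_const|exact Ha].
  + simpl. rewrite Rminus_diag, Rabs_R0, Rmult_0_l. reflexivity.
Qed.

(** Bounding the coefficients at radius [rho / 2] and staying within [rho / 4] gives the ratio 1/2.
    The estimate is uniform in [w], which is what later permits exchanging two summations. *)
Lemma pseries_geometric_approx {V : NormedModule C_AbsRing}
    (v : nat -> V) (f : C -> V) (rho : R) :
  0 < rho -> (forall w : C, disc rho w -> @is_pseries C_AbsRing V v w (f w)) ->
  exists r K, 0 < r <= rho /\ 0 <= K /\ forall w : C, Cmod w <= r ->
    norm (f w) <= K /\
    forall P, norm (minus (f w) (sum_n (fun p => scal (w ^ p)%C (v p)) P))
              <= K * (1 / 2) ^ P.
Proof.
intros Hrho Hf.
destruct (pseries_coefficient_bound v (rho / 2)) as [K [HK Hv]]; [lra| |].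
{ exists (f (RtoC (rho / 2))). apply Hf. unfold disc.
  rewrite Cmod_R, Rabs_pos_eq; lra. }
exists (rho / 4), (2 * K). split; [lra|]. split; [lra|]. intros w Hw.
assert (Hs : is_series (fun p => scal (w ^ p)%C (v p)) (f w)).
{ eapply is_series_ext; [|apply (Hf w); unfold disc; lra].
  intros p. cbv beta. now rewrite C_pow_n. }
assert (Hb : forall p, norm (scal (w ^ p)%C (v p)) <= K * (1 / 2) ^ p).
{ intros p. eapply Rle_trans; [apply norm_scal_C|]. rewrite Cmod_pow.
  assert (H1 : Cmod w ^ p <= (1 / 2 * (rho / 2)) ^ p).
  { apply pow_incr. split; [apply Cmod_ge_0|lra]. }
  rewrite Rpow_mult_distr in H1.
  assert (H2 := Rmult_le_compat_r _ _ _ (norm_ge_0 (v p)) H1).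
  assert (H3 := Rmult_le_compat_l _ _ _ (pow_le (1 / 2) p ltac:(lra)) (Hv p)).
  eapply Rle_trans; [exact H2|]. eapply Rle_trans; [|eapply Rle_trans; [exact H3|]]; right; ring. }
split.
- apply (is_series_norm_le (V := V) _ (fun p => K * (1 / 2) ^ p) _ _ Hb Hs).
  replace (2 * K) with (K * / (1 - 1 / 2)) by field.
  apply (is_series_scal K (fun p => (1 / 2) ^ p) (/ (1 - 1 / 2))).
  apply is_series_geom. rewrite Rabs_pos_eq; lra.
- intros P.
  eapply Rle_trans; [apply (geometric_tail_bound (V := V) _ _ K (1 / 2) P ltac:(lra) Hb Hs)|].
  assert (0 <= K * (1 / 2) ^ P) by (apply Rmult_le_pos; [lra|apply pow_le; lra]).
  simpl. lra.
Qed.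

Definition dilation_sum {V : CompleteNormedModule C_AbsRing}
    (e : nat -> R) (mu x : R) (f : C -> V) (z : C) : V :=
  iota (is_series (fun n => scal (RtoC (e n)) (f (RtoC (mu * x ^ n) * z)%C))).

Lemma is_series_iota {K : AbsRing} {V : CompleteNormedModule K} (a : nat -> V) :
  ex_series a -> is_series a (iota (is_series a)).
Proof.
intros [l Hl]. apply iota_correct. exists l. split; [exact Hl|].
intros l' Hl'. exact (is_series_unique_normed (V := V) a l l' Hl Hl').
Qed.

Lemma norm_scal_RtoC_le {V : NormedModule C_AbsRing} (c M : R) (u : V) :
  norm u <= M -> norm (scal (RtoC c) u) <= Rabs c * M.
Proof.
intros Hu. eapply Rle_trans; [apply norm_scal_C|]. rewrite Cmod_R.
apply Rmult_le_compat_l; [apply Rabs_pos|exact Hu].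
Qed.

Lemma Cmod_dilation (t : R) (z : C) :
  0 <= t -> Cmod (RtoC t * z) = t * Cmod z.
Proof. intros Ht. now rewrite Cmod_mult, Cmod_R, Rabs_pos_eq. Qed.

Lemma dilation_factor_bounds (mu x : R) (n : nat) :
  0 < mu -> 0 < x < 1 -> 0 < mu * x ^ n <= mu.
Proof.
intros Hmu Hx.
assert (0 < x ^ n) by (apply pow_lt; lra).
assert (x ^ n <= 1) by (rewrite <- (pow1 n); apply pow_incr; lra).
nra.
Qed.

(** The arguments mu x^n z tend to 0, so all but finitely many lie where f is bounded by [K], and
    there the absolutely summable weights give convergence. This makes [iota] meaningful at every
    [z], inside or outside the domain of holomorphy. *)
Lemma dilation_sum_correct {V : CompleteNormedModule C_AbsRing}
    (e : nat -> R) (mu x r K : R) (f : C -> V) (z : C) :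
  0 < mu -> 0 < x < 1 -> ex_series (fun n => Rabs (e n)) ->
  0 < r -> (forall w, Cmod w <= r -> norm (f w) <= K) ->
  is_series (fun n => scal (RtoC (e n)) (f (RtoC (mu * x ^ n) * z)%C))
            (dilation_sum e mu x f z).
Proof.
intros Hmu Hx He Hr Hf. apply is_series_iota.
assert (Hz := Cmod_ge_0 z).
(* From the index [N] on, mu x^n (|z| + 1) < r; the added 1 avoids dividing by zero at the
   origin. *)
destruct (pow_lt_1_zero x ltac:(rewrite Rabs_pos_eq; lra) (r / (mu * (Cmod z + 1))))
  as [N HN].
{ apply Rdiv_lt_0_compat; nra. }
apply (ex_series_incr_n _ N).
apply (ex_series_le (V := V) _ (fun k => Rabs (e (N + k)%nat) * K)).
- intros k. apply (norm_scal_RtoC_le (V := V)), Hf.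
  assert (Hd := dilation_factor_bounds mu x (N + k) Hmu Hx).
  rewrite Cmod_dilation by lra.
  specialize (HN (N + k)%nat ltac:(lia)).
  rewrite Rabs_pos_eq in HN by (apply pow_le; lra).
  apply Rmult_lt_compat_r with (r := mu * (Cmod z + 1)) in HN; [|nra].
  replace (r / (mu * (Cmod z + 1)) * (mu * (Cmod z + 1))) with r in HN by (field; nra).
  nra.
- apply ex_series_scal_r. apply (ex_series_incr_n (fun n => Rabs (e n)) N). exact He.
Qed.

(** The sums over n and p are exchanged by hand. For a partial sum in p the exchange is finite
    additivity ([Hfin]); the error K (1/2)^P is the same for every dilated argument, so weighting by
    the |e_n| leaves at most A K (1/2)^P. *)
Lemma dilation_sum_pseries {V : CompleteNormedModule C_AbsRing}
    (e W : nat -> R) (mu x r K : R) (v : nat -> V) (f : C -> V) (z : C) :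
  0 < mu -> 0 < x < 1 -> ex_series (fun n => Rabs (e n)) ->
  (forall p, is_series (fun n => e n * (mu * x ^ n) ^ p) (W p)) ->
  0 < r ->
  (forall w : C, Cmod w <= r -> norm (f w) <= K /\
    forall P, norm (minus (f w) (sum_n (fun p => scal (w ^ p)%C (v p)) P))
              <= K * (1 / 2) ^ P) ->
  mu * Cmod z <= r ->
  @is_pseries C_AbsRing V (fun p => scal (RtoC (W p)) (v p)) z
    (dilation_sum e mu x f z).
Proof.
intros Hmu Hx He HW Hr Hf Hz.
assert (Hg := dilation_sum_correct e mu x r K f z Hmu Hx He Hr
                (fun w Hw => proj1 (Hf w Hw))).
destruct He as [A HA].
set (w := fun n => (RtoC (mu * x ^ n) * z)%C).
set (s := sum_n (fun p => scal (@pow_n C_Ring z p) (scal (RtoC (W p)) (v p)))).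
assert (Hfin : forall P, is_series
  (fun n => scal (RtoC (e n)) (sum_n (fun p => scal (w n ^ p)%C (v p)) P)) (s P)).
{ assert (Hterm : forall p, is_series
    (fun n => scal (RtoC (e n)) (scal (w n ^ p)%C (v p)))
    (scal (@pow_n C_Ring z p) (scal (RtoC (W p)) (v p)))).
  { intros p. rewrite C_pow_n.
    eapply is_series_ext;
      [|exact (is_series_scal (V := V) (z ^ p)%C _ _
                 (is_series_scal_RtoC (V := V) _ _ (v p) (HW p)))].
    intros n. cbv beta. rewrite !scal_assoc. f_equal. unfold w.
    rewrite Cpow_mult_l, <- RtoC_pow, RtoC_mult.
    change (z ^ p * (e n * RtoC ((mu * x ^ n) ^ p))
            = e n * (RtoC ((mu * x ^ n) ^ p) * z ^ p))%C. ring. }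
  induction P as [|P IH].
  - unfold s. rewrite sum_O. eapply is_series_ext; [|apply (Hterm O)].
    intros n. cbv beta. now rewrite sum_O.
  - unfold s. rewrite sum_Sn.
    eapply is_series_ext; [|apply (is_series_plus _ _ _ _ IH (Hterm (S P)))].
    intros n. cbv beta. rewrite sum_Sn. symmetry. apply (scal_distr_l (V := V)). }
apply (filterlim_of_norm_bound (V := V) _ (fun P => (A * K) * (1 / 2) ^ P)).
- intros P. change (sum_n _ P) with (s P).
  eapply is_series_norm_le with (2 := is_series_minus _ _ _ _ Hg (Hfin P))
    (b := fun n => Rabs (e n) * (K * (1 / 2) ^ P)).
  + intros n.
    eapply Rle_trans; [right; apply f_equal; symmetry;
      exact (scal_minus_distr_l (V := V) (RtoC (e n)) (f (w n)) _)|].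
    apply (norm_scal_RtoC_le (V := V)), Hf. unfold w.
    assert (Hd := dilation_factor_bounds mu x n Hmu Hx).
    rewrite Cmod_dilation by lra. generalize (Cmod_ge_0 z); intros; nra.
  + rewrite Rmult_assoc. apply is_series_scal_r. exact HA.
- replace (Finite 0) with (Rbar_mult (A * K) 0) by (simpl; f_equal; ring).
  apply is_lim_seq_scal_l. apply is_lim_seq_geom. rewrite Rabs_pos_eq; lra.
Qed.

Lemma ex_derive_dilation {V : NormedModule C_AbsRing} (f : C -> V) (t : R) (z : C) :
  @ex_derive C_AbsRing V f (RtoC t * z)%C ->
  @ex_derive C_AbsRing V (fun y => f (RtoC t * y)%C) z.
Proof.
intros Hf.
apply (ex_derive_comp (K := C_AbsRing) (V := V) f (fun y : C => (RtoC t * y)%C) z Hf).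
exists (RtoC t).
(* The map is linear, so its remainder vanishes: the constant 0 works on any disc, here of radius
   1. *)
apply (is_derive_of_quadratic_remainder (V := AbsRing_NormedModule C_AbsRing)
         (fun y => RtoC t * y)%C z (RtoC t) 0 1); [lra|].
intros h _.
apply Rle_trans with (Cmod 0).
- right. apply (f_equal Cmod).
  change ((RtoC t * (z + h) - RtoC t * z) - h * RtoC t = 0)%C. ring.
- rewrite Cmod_0. lra.
Qed.

Lemma ex_derive_scal_C {V : NormedModule C_AbsRing} (f : C -> V) (c z : C) :
  @ex_derive C_AbsRing V f z ->
  @ex_derive C_AbsRing V (fun y => scal c (f y)) z.
Proof.
intros [D HD]. exists (scal c D).
eapply filterdiff_ext_lin.
- apply (filterdiff_scal_r_fct (K := C_AbsRing)
           (U := AbsRing_NormedModule C_AbsRing) (V := V) c f _ Cmult_comm HD).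
- intros y. cbv beta. rewrite !scal_assoc.
  apply (f_equal (fun t => scal t D)). apply Cmult_comm.
Qed.

Lemma ex_multiplier (e : nat -> R) (mu x : R) (p : nat) :
  0 < mu -> 0 < x < 1 -> ex_series (fun n => Rabs (e n)) ->
  ex_series (fun n => e n * (mu * x ^ n) ^ p).
Proof.
intros Hmu Hx He.
apply (ex_series_le (V := R_CompleteNormedModule) _ (fun n => Rabs (e n) * mu ^ p)).
- intros n. assert (Hd := dilation_factor_bounds mu x n Hmu Hx).
  change (Rabs (e n * (mu * x ^ n) ^ p) <= Rabs (e n) * mu ^ p).
  rewrite Rabs_mult. apply Rmult_le_compat_l; [apply Rabs_pos|].
  rewrite Rabs_pos_eq by (apply pow_le; lra). apply pow_incr; lra.
- apply ex_series_scal_r. exact He.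
Qed.

(* Peeling off the first [N] dilations leaves a sum that only sees [f] near
   the origin, where it is a power series; so no Cauchy theory is needed. *)
Lemma dilation_sum_ex_derive {V : CompleteNormedModule C_AbsRing}
    (x r K : R) (v : nat -> V) (f : C -> V) (z : C) (N : nat) :
  0 < x < 1 -> 0 < r ->
  (forall w : C, Cmod w <= r -> norm (f w) <= K /\
    forall P, norm (minus (f w) (sum_n (fun p => scal (w ^ p)%C (v p)) P))
              <= K * (1 / 2) ^ P) ->
  forall (e : nat -> R) (mu : R),
  0 < mu -> ex_series (fun n => Rabs (e n)) ->
  mu * x ^ N * Cmod z < r ->
  (forall n, @ex_derive C_AbsRing V f (RtoC (mu * x ^ n) * z)%C) ->
  @ex_derive C_AbsRing V (dilation_sum e mu x f) z.
Proof.
intros Hx Hr Hf.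
induction N as [|N IH]; intros e mu Hmu He Hz Hd.
- rewrite pow_O, Rmult_1_r in Hz.
  (* Every dilated argument now lies in the disc of radius [r], so the whole sum is a power series.
     After peeling, [e] is only a tail of the original weights, hence coefficients given by [Series]
     instead of a closed form. *)
  apply pseries_ex_derive with (rho := r / mu)
    (a := fun p => scal (RtoC (Series (fun n => e n * (mu * x ^ n) ^ p))) (v p)).
  + intros w Hw. unfold disc in Hw.
    apply (dilation_sum_pseries (V := V) e _ mu x r K v f w); try assumption.
    * intros p. apply Series_correct. now apply ex_multiplier.
    * apply Rmult_lt_compat_l with (r := mu) in Hw; [|lra].
      replace (mu * (r / mu)) with r in Hw by (field; lra). lra.
  + unfold disc. apply (Rmult_lt_reg_l mu); [lra|].
    replace (mu * (r / mu)) with r by (field; lra). lra.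
- assert (He' : ex_series (fun n => Rabs (e (S n))))
    by (apply (ex_series_incr_1 (fun n => Rabs (e n))); exact He).
  assert (Hmux : 0 < mu * x) by nra.
  assert (Hpow : forall n, mu * x ^ S n = mu * x * x ^ n) by (intros; simpl; ring).
  apply (ex_derive_ext (fun y => plus (scal (RtoC (e O)) (f (RtoC mu * y)%C))
           (dilation_sum (fun n => e (S n)) (mu * x) x f y))).
  + intros y.
    apply (is_series_unique_normed (V := V)
      (fun n => scal (RtoC (e n)) (f (RtoC (mu * x ^ n) * y)%C)));
      [|apply (dilation_sum_correct e mu x r K f y); try assumption; intros; now apply Hf].
    apply is_series_decr_1.
    eapply eq_ind_r with (x := dilation_sum (fun n => e (S n)) (mu * x) x f y);
      [|rewrite pow_O, Rmult_1_r;
        exact (minus_plus_cancel (G := V) (scal (RtoC (e O)) (f (RtoC mu * y)%C)) _)].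
    eapply is_series_ext; [|apply (dilation_sum_correct (fun n => e (S n)) (mu * x) x r K f y);
        try assumption; intros; now apply Hf].
    intros n. cbv beta. now rewrite Hpow.
  + apply (ex_derive_plus (V := V)).
    * apply (ex_derive_scal_C (V := V)). apply (ex_derive_dilation (V := V)).
      specialize (Hd O). now rewrite pow_O, Rmult_1_r in Hd.
    * apply IH; try assumption.
      -- rewrite <- Hpow. exact Hz.
      -- intros n. rewrite <- Hpow. apply Hd.
Qed.

(** A point of [U] keeps all its dilates in [U], also when [mu] exceeds 1; a point of the disc of
    radius [r / mu] is sent into the disc of radius [r]. In both cases [f] is differentiable at
    every argument that occurs. *)
Lemma dilation_sum_extension {V : CompleteNormedModule C_AbsRing}
    (e W : nat -> R) (mu x : R) (v : nat -> V) (U : C -> Prop) (f : C -> V) :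
  0 < mu -> 0 < x < 1 -> ex_series (fun n => Rabs (e n)) ->
  (forall p, is_series (fun n => e n * (mu * x ^ n) ^ p) (W p)) ->
  (forall t z, 0 < t -> U z -> U (RtoC t * z)%C) ->
  extension_on v U f ->
  extension_on (fun p => scal (RtoC (W p)) (v p)) U (dilation_sum e mu x f) /\
  forall z, is_series (fun n => scal (RtoC (e n)) (f (RtoC (mu * x ^ n) * z)%C))
                      (dilation_sum e mu x f z).
Proof.
intros Hmu Hx He HW HU [rho [Hrho [Hhol Hps]]].
destruct (pseries_geometric_approx (V := V) v f rho Hrho Hps)
  as [r [K [Hr [HK Hf]]]].
split; [|intros z; apply (dilation_sum_correct e mu x r K f z); try assumption;
  [lra|intros; now apply Hf]].
assert (Hscale : forall z : C, disc (r / mu) z -> mu * Cmod z < r).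
{ intros z Hz. unfold disc in Hz.
  apply Rmult_lt_compat_l with (r := mu) in Hz; [|lra].
  replace (mu * (r / mu)) with r in Hz by (field; lra). lra. }
exists (r / mu). split; [apply Rdiv_lt_0_compat; lra|]. split.
- intros z Hz. assert (Hz0 := Cmod_ge_0 z).
  destruct (pow_lt_1_zero x ltac:(rewrite Rabs_pos_eq; lra) (r / (mu * (Cmod z + 1))))
    as [N HN]; [apply Rdiv_lt_0_compat; nra|].
  specialize (HN N (le_n N)).
  rewrite Rabs_pos_eq in HN by (apply pow_le; lra).
  apply Rmult_lt_compat_r with (r := mu * (Cmod z + 1)) in HN; [|nra].
  replace (r / (mu * (Cmod z + 1)) * (mu * (Cmod z + 1))) with r in HN by (field; nra).
  apply (dilation_sum_ex_derive (V := V) x r K v f z N); try assumption; [lra| |].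
  + assert (0 < mu * x ^ N) by now apply dilation_factor_bounds. nra.
  + intros n. assert (Hd := dilation_factor_bounds mu x n Hmu Hx).
    apply Hhol. destruct Hz as [Hz|Hz]; [left; apply HU; [lra|exact Hz]|right].
    apply Hscale in Hz. unfold disc. rewrite Cmod_dilation by lra. nra.
- intros z Hz. apply Hscale in Hz.
  apply (dilation_sum_pseries (V := V) e W mu x r K v f z); try assumption; lra.
Qed.

(** * Growth on sectors *)

Lemma sector_dilation (d delta t : R) (z : C) :
  0 < t -> sector d delta z -> sector d delta (RtoC t * z)%C.
Proof.
intros Ht [r [phi [Hr [Hphi ->]]]]. exists (t * r), phi.
split; [nra|]. split; [exact Hphi|].
unfold RtoC, Cmult; simpl. f_equal; ring.
Qed.

Lemma sector_Cmod_pos (d delta : R) (z : C) : sector d delta z -> 0 < Cmod z.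
Proof.
intros [r [phi [Hr [_ ->]]]]. apply Cmod_gt_0. intros H.
injection H as H1 H2. assert (H3 := sin2_cos2 phi). unfold Rsqr in H3. nra.
Qed.

(** These are the moment sequences of signed measures of finite total variation with mass e_n at the
    point mu x^n. *)
Definition dilation_multiplier (W : nat -> R) : Prop :=
  exists (e : nat -> R) (mu x : R),
    0 < mu /\ 0 < x < 1 /\ ex_series (fun n => Rabs (e n)) /\
    forall p, is_series (fun n => e n * (mu * x ^ n) ^ p) (W p).

Definition nondecreasing_on_pos (phi : R -> R) : Prop :=
  forall a b, 0 < a <= b -> phi a <= phi b.

(** Since mu x^n |z| <= mu |z|, a nondecreasing majorant of f at the single radius mu |z| bounds all
    terms at once. Keeping [phi] abstract serves both growth conditions. *)
Lemma dilation_multiplier_extension {V : CompleteNormedModule C_AbsRing}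
    (W : nat -> R) (v : nat -> V) (d delta : R) (f : C -> V) :
  dilation_multiplier W -> extension_on v (sector d delta) f ->
  exists (g : C -> V) (mu A : R), 0 < mu /\ 0 < A /\
    convergent (fun p => scal (RtoC (W p)) (v p)) /\
    extension_on (fun p => scal (RtoC (W p)) (v p)) (sector d delta) g /\
    forall phi, nondecreasing_on_pos phi ->
      (forall z, sector d delta z -> norm (f z) <= phi (Cmod z)) ->
      forall z, sector d delta z -> norm (g z) <= A * phi (mu * Cmod z).
Proof.
intros [e [mu [x [Hmu [Hx [He HW]]]]]] Hf.
destruct (dilation_sum_extension (V := V) e W mu x v (sector d delta) f
            Hmu Hx He HW (sector_dilation d delta) Hf) as [Hext Hsum].
destruct He as [A HA].
assert (HA0 : 0 <= A).
{ apply Rle_trans with (Rabs A); [apply Rabs_pos|].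
  apply (is_series_norm_le (V := R_NormedModule) _ _ A A) with (2 := HA) (3 := HA).
  intros n. right. apply Rabs_Rabsolu. }
(* [A] is the sum of the |e_n| and could be 0; adding 1 makes the constant positive. *)
exists (dilation_sum e mu x f), mu, (A + 1).
split; [exact Hmu|]. split; [lra|]. split; [|split; [exact Hext|]].
- destruct Hext as [rho [Hrho [_ Hps]]]. exists rho. split; [exact Hrho|].
  intros z Hz. eexists. apply Hps, Hz.
- intros phi Hmono Hbound z Hz.
  assert (Hz0 := sector_Cmod_pos d delta z Hz).
  assert (Hterm : forall n, norm (f (RtoC (mu * x ^ n) * z)%C) <= phi (mu * Cmod z)).
  { intros n. assert (Hd := dilation_factor_bounds mu x n Hmu Hx).
    eapply Rle_trans; [apply Hbound, sector_dilation; [lra|exact Hz]|].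
    rewrite Cmod_dilation by lra. apply Hmono. nra. }
  apply Rle_trans with (A * phi (mu * Cmod z)).
  + apply (is_series_norm_le (V := V) _ (fun n => Rabs (e n) * phi (mu * Cmod z))
             _ _ (fun n => norm_scal_RtoC_le (V := V) _ _ _ (Hterm n)) (Hsum z)).
    apply is_series_scal_r. exact HA.
  + assert (H := Rle_trans _ _ _ (norm_ge_0 _) (Hterm O)). lra.
Qed.

Lemma exp_le (a b : R) : a <= b -> exp a <= exp b.
Proof. intros [H| ->]; [left; now apply exp_increasing|apply Rle_refl]. Qed.

(** The left side may decrease in r, when r + h < 1 or alpha < 0. Passing to h + 1 and |alpha|
    repairs this. As ln (r + h) lies between ln h and the nonnegative ln (r + h + 1), the loss is a
    constant depending on ln h. *)
Lemma q_growth_le_nondecreasing (D h alpha r : R) :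
  0 < D -> 0 < h -> 0 < r ->
  exp (ln (r + h) ^ 2 / D) * Rpower (r + h) alpha <=
  exp (ln h ^ 2 / D + Rabs alpha * Rabs (ln h)) *
    (exp (ln (r + h + 1) ^ 2 / D) * Rpower (r + h + 1) (Rabs alpha)).
Proof.
intros HD Hh Hr. unfold Rpower. rewrite <- !exp_plus.
apply exp_le.
assert (H1 : ln h <= ln (r + h)) by (apply ln_le; lra).
assert (H2 : ln (r + h) <= ln (r + h + 1)) by (apply ln_le; lra).
assert (H3 : 0 <= ln (r + h + 1)) by (rewrite <- ln_1; apply ln_le; lra).
set (L := ln (r + h)) in *. set (L' := ln (r + h + 1)) in *. set (m := ln h) in *.
assert (Hal : alpha * L <= Rabs alpha * Rabs L)
  by (rewrite <- Rabs_mult; apply Rle_abs).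
assert (Ha0 := Rabs_pos alpha).
assert (HL : Rabs L <= Rabs m + L').
{ unfold Rabs; destruct (Rcase_abs L), (Rcase_abs m); lra. }
assert (Hsq : L ^ 2 <= m ^ 2 + L' ^ 2).
{ destruct (Rle_dec 0 L); nra. }
assert (Hdiv : L ^ 2 / D <= m ^ 2 / D + L' ^ 2 / D).
{ unfold Rdiv. rewrite <- Rmult_plus_distr_r. apply Rmult_le_compat_r; [|exact Hsq].
  left; now apply Rinv_0_lt_compat. }
nra.
Qed.

Lemma q_growth_nondecreasing (D h alpha : R) :
  0 < D -> 0 <= alpha -> 1 <= h ->
  nondecreasing_on_pos (fun r => exp (ln (r + h) ^ 2 / D) * Rpower (r + h) alpha).
Proof.
intros HD Hal Hh a b [Ha Hab]. unfold Rpower. rewrite <- !exp_plus. apply exp_le.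
assert (H0 : 0 <= ln (a + h)) by (rewrite <- ln_1; apply ln_le; lra).
assert (H1 : ln (a + h) <= ln (b + h)) by (apply ln_le; lra).
apply Rplus_le_compat; [|nra].
unfold Rdiv. apply Rmult_le_compat_r; [left; now apply Rinv_0_lt_compat|nra].
Qed.

(** From mu r + h <= (mu + 1) (r + h), the logarithm grows by at most n = ln (mu + 1). In (n + M)^2
    the square n^2 is a constant factor, and the cross term 2 n M / D is a power of r + h, absorbed
    by enlarging alpha. Using mu + 1 covers mu < 1 as well. *)
Lemma q_growth_dilation (D h alpha mu r : R) :
  0 < D -> 0 <= alpha -> 1 <= h -> 0 < mu -> 0 < r ->
  exp (ln (mu * r + h) ^ 2 / D) * Rpower (mu * r + h) alpha <=
  exp (ln (mu + 1) ^ 2 / D + alpha * ln (mu + 1)) *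
    (exp (ln (r + h) ^ 2 / D) * Rpower (r + h) (alpha + 2 * ln (mu + 1) / D)).
Proof.
intros HD Hal Hh Hmu Hr. unfold Rpower. rewrite <- !exp_plus. apply exp_le.
assert (H0 : 0 <= ln (mu * r + h)) by (rewrite <- ln_1; apply ln_le; nra).
assert (H1 : ln (mu * r + h) <= ln (mu + 1) + ln (r + h)).
{ rewrite <- ln_mult by lra. apply ln_le; nra. }
set (L := ln (mu * r + h)) in *. set (M := ln (r + h)) in *. set (n := ln (mu + 1)) in *.
assert (Hsq : L ^ 2 / D <= (n + M) ^ 2 / D).
{ unfold Rdiv. apply Rmult_le_compat_r; [left; now apply Rinv_0_lt_compat|nra]. }
replace ((n + M) ^ 2 / D) with (n ^ 2 / D + M ^ 2 / D + 2 * n / D * M) in Hsq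
  by (field; lra).
nra.
Qed.

Lemma q_extendable_multiplier {V : CompleteNormedModule C_AbsRing}
    (W : nat -> R) (q s d : R) (v : nat -> V) :
  dilation_multiplier W -> 1 < q -> 0 < s ->
  q_extendable q s d v -> q_extendable q s d (fun p => scal (RtoC (W p)) (v p)).
Proof.
intros HW Hq Hs [_ [delta [f [Hdelta [Hext [c [h [alpha [Hc [Hh Hf]]]]]]]]]].
destruct (dilation_multiplier_extension (V := V) W v d delta f HW Hext)
  as [g [mu [A [Hmu [HA [Hconv [Hg Hbound]]]]]]].
split; [exact Hconv|]. exists delta, g. split; [exact Hdelta|]. split; [exact Hg|].
assert (HD : 0 < 2 * s * ln q).
{ apply Rmult_lt_0_compat; [lra|]. rewrite <- ln_1. apply ln_increasing; lra. }
set (D := 2 * s * ln q) in *.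
set (h' := h + 1). set (al := Rabs alpha).
assert (Hal : 0 <= al) by apply Rabs_pos.
set (c1 := c * exp (ln h ^ 2 / D + al * Rabs (ln h))).
assert (Hc1 : 0 < c1) by (apply Rmult_lt_0_compat; [lra|apply exp_pos]).
specialize (Hbound (fun r => c1 * (exp (ln (r + h') ^ 2 / D) * Rpower (r + h') al))).
exists (A * c1 * exp (ln (mu + 1) ^ 2 / D + al * ln (mu + 1))), h',
  (al + 2 * ln (mu + 1) / D).
split; [repeat apply Rmult_lt_0_compat; try assumption; apply exp_pos|].
split; [unfold h'; lra|]. intros z Hz.
eapply Rle_trans; [apply Hbound; [| |exact Hz]|].
- intros a b Hab. apply Rmult_le_compat_l; [lra|].
  apply (q_growth_nondecreasing D h' al HD Hal); [unfold h'; lra|exact Hab].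
- intros w Hw. eapply Rle_trans; [apply Hf, Hw|].
  assert (H := q_growth_le_nondecreasing D h alpha (Cmod w) HD Hh
                 (sector_Cmod_pos d delta w Hw)).
  apply Rmult_le_compat_l with (r := c) in H; [|lra].
  unfold c1, h', al. rewrite <- (Rplus_assoc (Cmod w)).
  rewrite (Rmult_assoc c (exp (_ + _))). rewrite (Rmult_assoc c). exact H.
- assert (H := q_growth_dilation D h' al mu (Cmod z) HD Hal ltac:(unfold h'; lra) Hmu
                 (sector_Cmod_pos d delta z Hz)).
  apply Rmult_le_compat_l with (r := A * c1) in H; [|nra].
  change (2 * s * ln q) with D. rewrite !Rmult_assoc in *. exact H.
Qed.

Lemma exponential_extendable_multiplier {V : CompleteNormedModule C_AbsRing}
    (W : nat -> R) (k d : R) (v : nat -> V) :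
  dilation_multiplier W -> 0 < k ->
  (exists (delta : R) (f : C -> V), 0 < delta /\
    extension_on v (sector d delta) f /\ exponential_growth k (sector d delta) f) ->
  convergent (fun p => scal (RtoC (W p)) (v p)) /\
  exists (delta : R) (f : C -> V), 0 < delta /\
    extension_on (fun p => scal (RtoC (W p)) (v p)) (sector d delta) f /\
    exponential_growth k (sector d delta) f.
Proof.
intros HW Hk [delta [f [Hdelta [Hext [A [B [HA [HB Hf]]]]]]]].
destruct (dilation_multiplier_extension (V := V) W v d delta f HW Hext)
  as [g [mu [A' [Hmu [HA' [Hconv [Hg Hbound]]]]]]].
split; [exact Hconv|]. exists delta, g. split; [exact Hdelta|]. split; [exact Hg|].
exists (A' * A), (B * Rpower mu k).
split; [nra|]. split; [apply Rmult_lt_0_compat; [lra|apply exp_pos]|].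
intros z Hz.
(* Since (mu |z|)^k = mu^k |z|^k, the dilation only changes the type B. *)
rewrite (Rmult_assoc B), Rpower_mult_distr, Rmult_assoc;
  [|exact Hmu|exact (sector_Cmod_pos d delta z Hz)].
apply (Hbound (fun r => A * exp (B * Rpower r k))); [|exact Hf|exact Hz].
intros a b Hab. apply Rmult_le_compat_l; [lra|]. apply exp_le.
apply Rmult_le_compat_l; [lra|]. apply Rle_Rpower_l; lra.
Qed.

(** * Euler's expansions *)

(** In closed form 1/(x;x)_n: the recursion is what F(y) - F(xy) = y F(y) imposes on the
    coefficients of F. *)
Fixpoint euler_coef (x : R) (n : nat) : R :=
  match n with O => 1 | S n' => euler_coef x n' / (1 - x ^ n) end.

(* Expands (y;x)_oo, where [euler_coef] expands its inverse. *)
Fixpoint signed_euler_coef (x : R) (n : nat) : R :=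
  match n with O => 1 | S n' => - (signed_euler_coef x n' * x ^ n') / (1 - x ^ n) end.

Fixpoint q_pochhammer (x : R) (p : nat) : R :=
  match p with O => 1 | S p' => q_pochhammer x p' * (1 - x ^ p) end.

Lemma pow_lt_1 (x : R) (n : nat) : 0 < x < 1 -> 0 < x ^ S n < 1.
Proof.
intros Hx. assert (0 < x ^ n) by (apply pow_lt; lra).
assert (x ^ n <= 1) by (rewrite <- (pow1 n); apply pow_incr; lra). simpl; nra.
Qed.

Lemma pow_S_le (x : R) (n : nat) : 0 < x < 1 -> 0 <= x ^ S n <= x.
Proof.
intros Hx. assert (0 < x ^ n) by (apply pow_lt; lra).
assert (x ^ n <= 1) by (rewrite <- (pow1 n); apply pow_incr; lra). simpl; nra.
Qed.

Lemma euler_coef_pos (x : R) (n : nat) : 0 < x < 1 -> 0 < euler_coef x n.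
Proof.
intros Hx. induction n as [|n IH]; cbn [euler_coef]; [lra|].
apply Rdiv_lt_0_compat; [exact IH|]. generalize (pow_lt_1 x n Hx); lra.
Qed.

(** The two coefficients differ by the factor (-1)^n x^(n(n-1)/2), of modulus at most 1; one
    majorant therefore serves both expansions. *)
Lemma signed_euler_coef_le (x : R) (n : nat) :
  0 < x < 1 -> Rabs (signed_euler_coef x n) <= euler_coef x n.
Proof.
intros Hx. induction n as [|n IH]; cbn [euler_coef signed_euler_coef].
- rewrite Rabs_R1; lra.
- assert (H := pow_lt_1 x n Hx). unfold Rdiv.
  rewrite Rabs_mult, Rabs_Ropp, Rabs_mult.
  rewrite (Rabs_pos_eq (/ _)) by (left; apply Rinv_0_lt_compat; lra).
  rewrite (Rabs_pos_eq (x ^ n)) by (apply pow_le; lra).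
  apply Rmult_le_compat_r; [left; apply Rinv_0_lt_compat; lra|].
  assert (x ^ n <= 1) by (rewrite <- (pow1 n); apply pow_incr; lra).
  assert (0 <= x ^ n) by (apply pow_le; lra).
  generalize (Rabs_pos (signed_euler_coef x n)); nra.
Qed.

Lemma ex_series_euler (x : R) :
  0 < x < 1 -> ex_series (fun n => euler_coef x n * x ^ n).
Proof.
intros Hx.
apply (ex_series_ext (fun n => Rabs (euler_coef x n * x ^ n))).
{ intros n. apply Rabs_pos_eq, Rmult_le_pos; [left; now apply euler_coef_pos|].
  apply pow_le; lra. }
apply ex_series_DAlembert with (k := x); [lra| |].
{ intros n. apply Rmult_integral_contrapositive.
  split; [apply Rgt_not_eq, euler_coef_pos, Hx|apply pow_nonzero; lra]. }
(* This is the ratio of consecutive terms; it tends to x < 1. *)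
apply (is_lim_seq_ext (fun n => x * / (1 - x ^ S n))).
{ intros n. assert (H := pow_lt_1 x n Hx). assert (H1 := euler_coef_pos x n Hx).
  assert (H2 : 0 < x ^ n) by (apply pow_lt; lra).
  rewrite Rabs_pos_eq.
  - cbn [euler_coef]. simpl pow in *. field. repeat split; lra.
  - apply Rlt_le, Rdiv_lt_0_compat; apply Rmult_lt_0_compat;
      try apply euler_coef_pos; lra. }
replace (Finite x) with (Rbar_mult x (/ (1 - 0))) by (simpl; f_equal; field).
apply is_lim_seq_scal_l.
apply (is_lim_seq_inv _ (Finite (1 - 0))); [|simpl; intros H; injection H; lra].
apply is_lim_seq_minus'; [apply is_lim_seq_const|].
apply (is_lim_seq_incr_1 (fun n => x ^ n)).
apply is_lim_seq_geom. rewrite Rabs_pos_eq; lra.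
Qed.

(** Only the points x^(p+1) are ever sampled, so the range 0 <= y <= x suffices and the series at y
    = x is a majorant for all of them. *)
Lemma dominated_euler_series (x : R) (c : nat -> R) (y : R) :
  0 < x < 1 -> (forall n, Rabs (c n) <= euler_coef x n) -> 0 <= y <= x ->
  ex_series (fun n => Rabs (c n * y ^ n)) /\
  is_series (fun n => c n * y ^ n) (Series (fun n => c n * y ^ n)).
Proof.
intros Hx Hc Hy.
assert (H : ex_series (fun n => Rabs (c n * y ^ n))).
{ apply (ex_series_le (V := R_CompleteNormedModule) _ (fun n => euler_coef x n * x ^ n));
    [|now apply ex_series_euler].
  intros n. change (Rabs (Rabs (c n * y ^ n)) <= euler_coef x n * x ^ n).
  rewrite Rabs_Rabsolu, Rabs_mult, (Rabs_pos_eq (y ^ n)) by (apply pow_le; lra).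
  apply Rmult_le_compat; [apply Rabs_pos|apply pow_le; lra|apply Hc|].
  apply pow_incr; lra. }
split; [exact H|]. apply Series_correct, ex_series_Rabs, H.
Qed.

Definition euler_series (x y : R) : R := Series (fun n => euler_coef x n * y ^ n).
Definition signed_euler_series (x y : R) : R :=
  Series (fun n => signed_euler_coef x n * y ^ n).

Lemma is_series_euler (x y : R) : 0 < x < 1 -> 0 <= y <= x ->
  is_series (fun n => euler_coef x n * y ^ n) (euler_series x y).
Proof.
intros Hx Hy. apply (dominated_euler_series x _ y Hx); [|exact Hy].
intros n. rewrite Rabs_pos_eq; [lra|left; now apply euler_coef_pos].
Qed.

Lemma is_series_signed_euler (x y : R) : 0 < x < 1 -> 0 <= y <= x ->
  is_series (fun n => signed_euler_coef x n * y ^ n) (signed_euler_series x y).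
Proof.
intros Hx Hy. apply (dominated_euler_series x _ y Hx); [|exact Hy].
intros n. now apply signed_euler_coef_le.
Qed.

(** In f(y) - f(xy) the constant terms cancel and y^(n+1) has coefficient c_(n+1) (1 - x^(n+1)).
    Both coefficient recursions are designed to simplify this product. *)
Lemma is_series_shift (c a : nat -> R) (x y l l' : R) :
  (forall n, c (S n) * (1 - x ^ S n) = a n) ->
  is_series (fun n => c n * y ^ n) l -> is_series (fun n => c n * (x * y) ^ n) l' ->
  is_series (fun n => y * (a n * y ^ n)) (l - l').
Proof.
intros Hca Hl Hl'.
assert (H := is_series_minus _ _ _ _ Hl Hl').
apply (is_series_ext (fun n => c (S n) * y ^ S n + - (c (S n) * (x * y) ^ S n))).
- intros n. rewrite <- Hca, Rpow_mult_distr. simpl. ring.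
- apply (is_series_incr_1 (fun n => c n * y ^ n + - (c n * (x * y) ^ n))).
  eapply (eq_ind_r (fun t => is_series _ t)); [exact H|].
  change (l - l' + (c O * y ^ O + - (c O * (x * y) ^ O)) = l + - l'). simpl; ring.
Qed.

Lemma euler_series_dilation (x y : R) : 0 < x < 1 -> 0 <= y <= x ->
  euler_series x (x * y) = (1 - y) * euler_series x y.
Proof.
intros Hx Hy.
assert (H := is_series_shift (euler_coef x) (euler_coef x) x y _ _
  ltac:(intros n; generalize (pow_lt_1 x n Hx); intros; cbn [euler_coef]; field; lra)
  (is_series_euler x y Hx Hy) (is_series_euler x (x * y) Hx ltac:(nra))).
apply is_series_unique in H.
rewrite Series_scal_l in H. unfold euler_series in *. lra.
Qed.

(** The extra x^n in the signed recursion turns y^n into (xy)^n, so G(y) - G(xy) = -y G(xy) rather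
    than a multiple of G(y). *)
Lemma signed_euler_series_dilation (x y : R) : 0 < x < 1 -> 0 <= y <= x ->
  signed_euler_series x y = (1 - y) * signed_euler_series x (x * y).
Proof.
intros Hx Hy.
assert (H := is_series_shift (signed_euler_coef x)
  (fun n => - (signed_euler_coef x n * x ^ n)) x y _ _
  ltac:(intros n; generalize (pow_lt_1 x n Hx); intros; cbn [signed_euler_coef]; field; lra)
  (is_series_signed_euler x y Hx Hy) (is_series_signed_euler x (x * y) Hx ltac:(nra))).
apply is_series_unique in H.
rewrite Series_scal_l in H.
rewrite (Series_ext _ (fun n => - (signed_euler_coef x n * (x * y) ^ n))) in H
  by (intros n; rewrite Rpow_mult_distr; ring).
rewrite Series_opp in H. unfold signed_euler_series in *. lra.
Qed.

Lemma q_pochhammer_pos (x : R) (p : nat) : 0 < x < 1 -> 0 < q_pochhammer x p.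
Proof.
intros Hx. induction p as [|p IH]; cbn [q_pochhammer]; [lra|].
apply Rmult_lt_0_compat; [exact IH|]. generalize (pow_lt_1 x p Hx); lra.
Qed.

Lemma euler_series_pow (x : R) (p : nat) : 0 < x < 1 ->
  euler_series x (x ^ S p) = q_pochhammer x p * euler_series x x.
Proof.
intros Hx. induction p as [|p IH]; cbn [q_pochhammer].
- now rewrite pow_1, Rmult_1_l.
- change (x ^ S (S p)) with (x * x ^ S p).
  rewrite euler_series_dilation, IH; [ring|exact Hx|now apply pow_S_le].
Qed.

Lemma signed_euler_series_pow (x : R) (p : nat) : 0 < x < 1 ->
  signed_euler_series x x = q_pochhammer x p * signed_euler_series x (x ^ S p).
Proof.
intros Hx. induction p as [|p IH]; cbn [q_pochhammer].
- now rewrite pow_1, Rmult_1_l.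
- rewrite IH, signed_euler_series_dilation; [|exact Hx|now apply pow_S_le].
  change (x ^ S (S p)) with (x * x ^ S p). ring.
Qed.

Lemma Series_ge_head (a : nat -> R) :
  (forall n, 0 <= a n) -> ex_series a -> a O <= Series a.
Proof.
intros Ha He. rewrite (Series_incr_1 a He).
(* The zero sequence is written 0 * 0 so that [Series_scal_l] pulls out a factor 0 and evaluates its
   sum. *)
assert (H := Series_le (fun _ => 0 * 0) (fun k => a (S k))).
rewrite Series_scal_l in H.
assert (0 * Series (fun _ => 0) <= Series (fun k => a (S k))); [|lra].
apply H; [intros n; rewrite Rmult_0_l; split; [lra|apply Ha]|].
now apply (ex_series_incr_1 a).
Qed.

Lemma euler_series_pos (x : R) : 0 < x < 1 -> 0 < euler_series x x.
Proof.
intros Hx. apply Rlt_le_trans with (euler_coef x O * x ^ O); [simpl; lra|].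
apply (Series_ge_head (fun n => euler_coef x n * x ^ n)); [|now apply ex_series_euler].
intros n. apply Rmult_le_pos; [left; now apply euler_coef_pos|apply pow_le; lra].
Qed.

(* Otherwise the series would vanish at every x^(p+1), although it tends to 1
   there. *)
Lemma signed_euler_series_neq_0 (x : R) : 0 < x < 1 -> signed_euler_series x x <> 0.
Proof.
intros Hx Hzero.
assert (HF := euler_series_pos x Hx).
(* With this [p], x^p F(x) < 1 for F = [euler_series x]. Vanishing at x^(p+1) would force the terms
   after the leading 1 to sum to -1, while they are bounded by x^p (F(x) - 1) < 1. *)
destruct (pow_lt_1_zero x ltac:(rewrite Rabs_pos_eq; lra) (/ euler_series x x))
  as [p Hp]; [now apply Rinv_0_lt_compat|].
specialize (Hp p (le_n p)). rewrite Rabs_pos_eq in Hp by (apply pow_le; lra).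
rewrite (signed_euler_series_pow x p Hx) in Hzero.
assert (Hpoch := q_pochhammer_pos x p Hx).
assert (Hzero' : signed_euler_series x (x ^ S p) = 0) by nra.
assert (Hxp : x ^ p <= 1) by (rewrite <- (pow1 p); apply pow_incr; lra).
assert (Hxp0 : 0 < x ^ p) by (apply pow_lt; lra).
assert (Hser := is_series_signed_euler x (x ^ S p) Hx ltac:(simpl; nra)).
rewrite Hzero' in Hser.
assert (Htail : is_series (fun n => signed_euler_coef x (S n) * (x ^ S p) ^ S n) (- 1)).
{ apply (is_series_incr_1 (fun n => signed_euler_coef x n * (x ^ S p) ^ n)).
  eapply (eq_ind_r (fun t => is_series _ t)); [exact Hser|].
  change (- 1 + 1 * 1 = 0). ring. }
assert (H1 : Rabs (- 1) <= x ^ p * (euler_series x x - 1)).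
{ apply (is_series_norm_le (V := R_NormedModule) _
    (fun n => x ^ p * (euler_coef x (S n) * x ^ S n)) (- 1) _) with (2 := Htail).
  - intros n.
    change (Rabs (signed_euler_coef x (S n) * (x ^ S p) ^ S n)
            <= x ^ p * (euler_coef x (S n) * x ^ S n)).
    rewrite Rabs_mult, (Rabs_pos_eq (_ ^ S n)) by (repeat apply pow_le; lra).
    assert (H2 : (x ^ S p) ^ S n <= x ^ p * x ^ S n).
    { change (x ^ S p) with (x * x ^ p). rewrite Rpow_mult_distr, Rmult_comm.
      apply Rmult_le_compat_r; [apply pow_le; lra|].
      rewrite <- (Rmult_1_r (x ^ p)) at 2. change ((x ^ p) ^ S n) with (x ^ p * (x ^ p) ^ n).
      apply Rmult_le_compat_l; [lra|]. rewrite <- (pow1 n). apply pow_incr; lra. }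
    eapply Rle_trans; [apply Rmult_le_compat; [apply Rabs_pos|repeat apply pow_le; lra
      |now apply signed_euler_coef_le|exact H2]|]. right; ring.
  - apply (is_series_scal (x ^ p) (fun n => euler_coef x (S n) * x ^ S n)).
    apply (is_series_incr_1 (fun n => euler_coef x n * x ^ n)).
    eapply (eq_ind_r (fun t => is_series _ t)); [apply (is_series_euler x x Hx); lra|].
    change (euler_series x x - 1 + 1 * 1 = euler_series x x). ring. }
rewrite Rabs_left in H1 by lra.
apply Rmult_lt_compat_r with (r := euler_series x x) in Hp; [|exact HF].
rewrite Rinv_l in Hp by lra. lra.
Qed.

(** * q-factorials and their inverses as dilation multipliers *)

Lemma qfactorial_q_pochhammer (x : R) (p : nat) : 0 < x < 1 ->
  qfactorial x p = q_pochhammer x p * (/ (1 - x)) ^ p.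
Proof.
intros Hx. induction p as [|p IH]; cbn [q_pochhammer qfactorial]; [simpl; ring|].
rewrite IH. unfold qnumber. simpl. field. lra.
Qed.

Lemma qfactorial_pos (x : R) (p : nat) : 0 < x < 1 -> 0 < qfactorial x p.
Proof.
intros Hx. rewrite qfactorial_q_pochhammer by exact Hx.
apply Rmult_lt_0_compat; [now apply q_pochhammer_pos|].
apply pow_lt, Rinv_0_lt_compat; lra.
Qed.

(** Expanding w at x^(p+1) gives the terms c_n x^n (x^n)^p, hence the weights a c_n x^n. Sampling at
    exponent p + 1 rather than p supplies the factor x^n that makes them summable; [euler_coef]
    itself stays above 1. *)
Lemma dilation_multiplier_of_series (x mu a : R) (c W : nat -> R) (w : R -> R) :
  0 < x < 1 -> 0 < mu ->
  (forall n, Rabs (c n) <= euler_coef x n) ->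
  (forall y, 0 <= y <= x -> is_series (fun n => c n * y ^ n) (w y)) ->
  (forall p, W p = a * mu ^ p * w (x ^ S p)) ->
  dilation_multiplier W.
Proof.
intros Hx Hmu Hc Hw HW.
exists (fun n => a * (c n * x ^ n)), mu, x.
split; [exact Hmu|]. split; [exact Hx|]. split.
- apply (ex_series_ext (fun n => Rabs a * Rabs (c n * x ^ n)));
    [intros n; now rewrite <- Rabs_mult|].
  apply (ex_series_scal (Rabs a) (fun n => Rabs (c n * x ^ n))).
  apply (dominated_euler_series x c x Hx Hc). lra.
- intros p. rewrite HW.
  eapply is_series_ext; [|apply (is_series_scal (a * mu ^ p) _ _ (Hw (x ^ S p) (pow_S_le x p Hx)))].
  intros n. change (a * mu ^ p * (c n * (x ^ S p) ^ n)
                    = a * (c n * x ^ n) * (mu * x ^ n) ^ p).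
  rewrite Rpow_mult_distr, <- !pow_mult.
  replace (S p * n)%nat with (n + n * p)%nat by lia. rewrite pow_add. ring.
Qed.

Lemma qfactorial_dilation_multiplier (x : R) :
  0 < x < 1 -> dilation_multiplier (qfactorial x).
Proof.
intros Hx. assert (HF := euler_series_pos x Hx).
apply (dilation_multiplier_of_series x (/ (1 - x)) (/ euler_series x x)
         (euler_coef x) _ (euler_series x) Hx).
- apply Rinv_0_lt_compat; lra.
- intros n. rewrite Rabs_pos_eq; [lra|left; now apply euler_coef_pos].
- intros y Hy. now apply is_series_euler.
- intros p. rewrite euler_series_pow, qfactorial_q_pochhammer by exact Hx. field; lra.
Qed.

Lemma inv_qfactorial_dilation_multiplier (x : R) :
  0 < x < 1 -> dilation_multiplier (fun p => / qfactorial x p).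
Proof.
intros Hx. assert (HG := signed_euler_series_neq_0 x Hx).
apply (dilation_multiplier_of_series x (1 - x) (/ signed_euler_series x x)
         (signed_euler_coef x) _ (signed_euler_series x) Hx).
- lra.
- intros n. now apply signed_euler_coef_le.
- intros y Hy. now apply is_series_signed_euler.
- intros p. assert (Hpoch := q_pochhammer_pos x p Hx).
  rewrite qfactorial_q_pochhammer by exact Hx.
  (* Writing G(x) as (x;x)_p G(x^(p+1)) in both places turns G(x) <> 0 into G(x^(p+1)) <> 0, which
     the division requires. *)
  assert (Hp := signed_euler_series_pow x p Hx). rewrite Hp in HG |- *.
  rewrite pow_inv. assert ((1 - x) ^ p <> 0) by (apply pow_nonzero; lra).
  field. split; [|split]; try lra. intros H0. apply HG. rewrite H0. ring.
Qed.

(** * Formal Borel operators and the two preservation properties *)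

Lemma borel_comm_multiplier {V : CompleteNormedModule C_AbsRing}
    (m m' : nat -> R) (u : nat -> V) :
  borel m (borel m' u) = (fun p => scal (RtoC (/ m' p)) (borel m u p)).
Proof.
apply functional_extensionality. intros p. unfold borel.
rewrite !scal_assoc. apply (f_equal (fun c => scal c (u p))). apply Cmult_comm.
Qed.

Lemma borel_cancel_multiplier {V : CompleteNormedModule C_AbsRing}
    (m m' : nat -> R) (u : nat -> V) : (forall p, m' p <> 0) ->
  borel m u = (fun p => scal (RtoC (m' p)) (borel m (borel m' u) p)).
Proof.
intros Hm'. rewrite borel_comm_multiplier.
apply functional_extensionality. intros p.
rewrite scal_assoc.
replace (mult _ _) with (one : C_AbsRing); [now rewrite scal_one|].
change (RtoC 1 = (RtoC (m' p) * RtoC (/ m' p))%C).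
rewrite <- RtoC_mult. f_equal. field. apply Hm'.
Qed.

Theorem theorem4 (q : R) (hq : 1 < q) (E : CompleteNormedModule C_AbsRing) :
  preserves_summability E (fun p : nat => qfactorial (1 / q) p) /\
  preserves_q_Gevrey E q (fun p : nat => qfactorial (1 / q) p).
Proof.
assert (Hx : 0 < 1 / q < 1).
{ split; [apply Rdiv_lt_0_compat; lra|]. apply (Rmult_lt_reg_r q); [lra|].
  replace (1 / q * q) with 1 by (field; lra). lra. }
set (m := fun p : nat => qfactorial (1 / q) p).
assert (Hnorm : normalized_positive m)
  by (split; [reflexivity|intros p; now apply qfactorial_pos]).
assert (Hm : forall p, m p <> 0) by (intros p; apply Rgt_not_eq, Hnorm).
assert (HW := qfactorial_dilation_multiplier (1 / q) Hx).
assert (HW' := inv_qfactorial_dilation_multiplier (1 / q) Hx).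
split; split; try exact Hnorm.
(* [borel m] divides the coefficients by the q-factorials, so the direct implications use the
   inverse multiplier [HW'] and the converses multiply back with [HW]. *)
- intros k d u Hk. unfold summable. split; intros [_ H].
  + rewrite borel_comm_multiplier.
    exact (exponential_extendable_multiplier _ k d _ HW' Hk H).
  + rewrite (borel_cancel_multiplier _ m u Hm).
    exact (exponential_extendable_multiplier _ k d _ HW Hk H).
- intros s d u Hs. unfold q_borel. split; intros H.
  + rewrite borel_comm_multiplier.
    exact (q_extendable_multiplier _ q s d _ HW' hq Hs H).
  + rewrite (borel_cancel_multiplier _ m u Hm).
    exact (q_extendable_multiplier _ q s d _ HW hq Hs H).
Qed.
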